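(* Let $a\in\mathcal{A}$ and let $m\geq 1$ be an integer. Then $a$ has an $m$-generalized right group inverse if and only if (1) $a$ has a generalized right Drazin inverse, and (2) there exists $x\in\mathcal{A}$ such that $$x=ax^2,\qquad [(a^m)^*a^{m+1}x]^*=(a^m)^*a^{m+1}x,\qquad \lim_{n\to\infty}\|a^n-axa^{n}\|^{1/n}=0.$$ In this case, for any generalized right Drazin inverse $d$ of $a$ and any $x$ as in (2), the element $adx$ is an $m$-generalized right group inverse of $a$.
   Context: $\mathcal{A}$ is a unital complex Banach *-algebra, i.e. a Banach algebra with an involution $*$ satisfying $(x+y)^*=x^*+y^*$, $(\lambda x)^*=\overline{\lambda}x^*$, $(xy)^*=y^*x^*$, $(x^* )^*=x$; the involution is assumed proper: $x^*x=0$ implies $x=0$. $\mathcal{A}^{qnil}=\{x\in\mathcal{A}: \lim_{n\to\infty}\|x^n\|^{1/n}=0\}$. An element $d\in\mathcal{A}$ is a generalized right Drazin inverse of $a$ if $ad^2=d$, $a^2d=ada$ and $a-ada\in\mathcal{A}^{qnil}$ (it need not be unique). An element $x\in\mathcal{A}$ is an $m$-generalized right group inverse of $a$ if there is a generalized right Drazin inverse $d$ of $a$ such that $x=ax^2$, $(ad)^*a^{m+1}x=(ad)^*a^m$ and $\lim_{n\to\infty}\|a^n-axa^n\|^{1/n}=0$. It need not be unique. *)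

(* Defs.v *)
From HB Require Import structures.
From mathcomp Require Import all_boot all_order all_algebra.
From mathcomp Require Export complex.
From mathcomp Require Export all_classical all_reals all_analysis.

Set Implicit Arguments.
Unset Strict Implicit.
Unset Printing Implicit Defensive.

Import Order.TTheory GRing.Theory Num.Theory.
Import numFieldNormedType.Exports.

Local Open Scope classical_set_scope.
Local Open Scope ring_scope.

(* Hierarchy-Builder cannot join the normed-module and ring hierarchies (the join
   would have to sit above NumDomain), so a Banach algebra is packed here as a
   complete normed space with a product; the library's two structures are then
   put on the same carrier [banach_sort].
   Neither |1| = 1 nor continuity of the involution is required. *)
Record banachAlg (R : realType) := BanachAlg {
  banach_space : completeNormedModType R[i] ;
  banach_one : banach_space ;
  banach_mul : banach_space -> banach_space -> banach_space ;
  banach_mulA : associative banach_mul ;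
  banach_mul1l : left_id banach_one banach_mul ;
  banach_mul1r : right_id banach_one banach_mul ;
  banach_mulDl : left_distributive banach_mul +%R ;
  banach_mulDr : right_distributive banach_mul +%R ;
  banach_oner_neq0 : banach_one != 0 ;
  banach_scaleAl : forall (c : R[i]) (x y : banach_space),
    c *: banach_mul x y = banach_mul (c *: x) y ;
  banach_scaleAr : forall (c : R[i]) (x y : banach_space),
    c *: banach_mul x y = banach_mul x (c *: y) ;
  banach_normM_subproof : forall x y : banach_space,
    `|banach_mul x y| <= `|x| * `|y|
}.

Definition banach_sort (R : realType) (A : banachAlg R) : Type :=
  banach_space A.
Coercion banach_sort : banachAlg >-> Sortclass.

Section BanachAlgInstances.
Variables (R : realType) (A : banachAlg R).

HB.instance Definition _ :=
  CompleteNormedModule.copy (banach_sort A) (banach_space A).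
HB.instance Definition _ := GRing.Zmodule_isNzRing.Build (banach_sort A)
  (@banach_mulA R A) (@banach_mul1l R A) (@banach_mul1r R A)
  (@banach_mulDl R A) (@banach_mulDr R A) (@banach_oner_neq0 R A).
HB.instance Definition _ :=
  GRing.Lmodule_isLalgebra.Build R[i] (banach_sort A) (@banach_scaleAl R A).
HB.instance Definition _ :=
  GRing.Lalgebra_isAlgebra.Build R[i] (banach_sort A) (@banach_scaleAr R A).

Lemma banach_normM (x y : A) : `|x * y| <= `|x| * `|y|.
Proof. exact: banach_normM_subproof. Qed.

End BanachAlgInstances.

Record banachStarAlg (R : realType) := BanachStarAlg {
  banach_alg :> banachAlg R ;
  star : banach_alg -> banach_alg ;
  starD : forall x y : banach_alg, star (x + y) = star x + star y ;
  starZ : forall (c : R[i]) (x : banach_alg), star (c *: x) = c^* *: star x ;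
  starM : forall x y : banach_alg, star (x * y) = star y * star x ;
  starK : forall x : banach_alg, star (star x) = x
}.

Section GeneralizedRightInverses.
Variables (R : realType) (A : banachStarAlg R).
Implicit Types (a d x : A) (m n : nat).

Definition proper_involution : Prop :=
  forall x, star x * x = 0 -> x = 0.

(* The norm of a normed module over R[i] takes its values in R[i]; these values
   are nonnegative reals, so the real part only changes their type. *)
Definition rnorm x : R := complex.Re `|x|.

(* The term of index 0 carries the junk exponent 0^-1 = 0, which does not
   affect the limit. *)
Definition root_norm_cvg0 (u : nat -> A) : Prop :=
  (fun n : nat => rnorm (u n) `^ n%:R^-1) @ \oo --> (0 : R).

Definition qnil x : Prop := root_norm_cvg0 (fun n => x ^+ n).

Definition gen_right_drazin_inverse a d : Prop :=
  [/\ a * d ^+ 2 = d, a ^+ 2 * d = a * d * a & qnil (a - a * d * a)].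

Definition gen_right_group_inverse m a x : Prop :=
  exists2 d, gen_right_drazin_inverse a d &
    [/\ x = a * x ^+ 2,
        star (a * d) * a ^+ m.+1 * x = star (a * d) * a ^+ m &
        root_norm_cvg0 (fun n => a ^+ n - a * x * a ^+ n)].

End GeneralizedRightInverses.

Arguments proper_involution {R} A.

(* Main.v *)
(** With [p = a d], the element [p] is an idempotent commuting with [a], and
    [a (1 - p)] is quasinilpotent. Put [q = a x]. If [x = a x^2] then
    [(1 - p) q = (a (1 - p))^n x^n] for every [n >= 1]; if moreover
    [|a^n - a x a^n|^(1/n)] tends to 0, then [(1 - q) p = (a^n - a x a^n) d^n].
    Comparing growth rates, both constants vanish, so [q] is an idempotent with
    [p q = q] and [q p = p]. In particular [a d x = x], and it remains to see that
    [p^* a^m q = p^* a^m] amounts to [(a^m)^* a^m q] being self-adjoint. Both say that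
    [a^m (1 - q)] is orthogonal to [a^m q], since [a^m q = p a^m q] and
    [p = a^m q d^m]. *)
Require Import Defs.
From HB Require Import structures.
From mathcomp Require Import all_boot all_order all_algebra.
From mathcomp Require Import complex.
From mathcomp Require Import all_classical all_reals all_analysis.

Import Order.TTheory GRing.Theory Num.Theory.
Import numFieldNormedType.Exports.
Local Open Scope classical_set_scope.
Local Open Scope ring_scope.

Section RootNorm.
Variables (R : realType) (A : banachStarAlg R).
Implicit Types (x y z : A).

Lemma rnormE x : (rnorm x)%:C%C = `|x|.
Proof. by rewrite /rnorm RRe_real // ger0_real. Qed.

Lemma rnorm_ge0 x : 0 <= rnorm x.
Proof. by rewrite -ler0c rnormE. Qed.

Lemma rnormM x y : rnorm (x * y) <= rnorm x * rnorm y.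
Proof. by rewrite -lecR rmorphM /= !rnormE; exact: banach_normM. Qed.

(** Exponent 0 is excluded because [rnorm 1] may exceed 1. *)
Lemma rnormX x n : rnorm (x ^+ n.+1) <= rnorm x ^+ n.+1.
Proof.
elim: n => [|n IHn]; first by rewrite !expr1.
rewrite exprS [leRHS]exprS; apply: le_trans (rnormM _ _) _.
by rewrite ler_wpM2l ?rnorm_ge0.
Qed.

Lemma rnorm_eq0 x : rnorm x = 0 -> x = 0.
Proof. by move=> x0; apply/normr0_eq0; rewrite -rnormE x0. Qed.

(** The sequence [u] decays faster than any geometric sequence, while the powers of [y] grow at most
    geometrically. *)
Lemma root_norm_cvg0_expr_eq0 (u : nat -> A) y z :
  root_norm_cvg0 u -> (forall n, z = u n.+1 * y ^+ n.+1) -> z = 0.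
Proof.
move=> ucvg zE; apply/rnorm_eq0/le_anti; rewrite rnorm_ge0 andbT.
(* The summand 1 keeps [M] positive even if [y = 0]. Bounding the roots by [(2 * M)^-1] leaves
   [2^-1 ^+ n] after multiplication by [M ^+ n]. *)
pose M := 1 + rnorm y; have M0 : 0 < M by rewrite ltr_wpDr ?rnorm_ge0.
have half_cvg : (fun n => 2^-1 ^+ n) @ \oo --> (0 : R).
  by apply: cvg_expr; rewrite ger0_norm ?invr_ge0 // invf_lt1 // ltr1n.
rewrite -(cvg_lim _ half_cvg) //; apply: limr_ge; first by apply/cvg_ex; exists 0.
have e0 : 0 < (2 * M)^-1 by rewrite invr_gt0 mulr_gt0.
move/cvgr0Pnorm_lt : ucvg => /(_ _ e0) small.
near=> n.
(* At index 0 the exponent is [0^-1 = 0], so the power undoes the root only for positive [n]. *)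
have n0 : (0 < n)%N by near: n; exists 1%N.
have un : rnorm (u n) <= (2 * M)^-1 ^+ n.
  have : `|rnorm (u n) `^ n%:R^-1| < (2 * M)^-1 by near: n.
  rewrite ger0_norm ?powR_ge0 // => /ltW /(lerXn2r n).
  rewrite !nnegrE powR_ge0 ltW // => /(_ isT isT).
  rewrite -[X in X <= _]powR_mulrn ?powR_ge0 // -powRrM mulVf ?pnatr_eq0 -?lt0n //.
  by rewrite powRr1 ?rnorm_ge0.
have yn : rnorm (y ^+ n) <= M ^+ n.
  rewrite -(prednK n0); apply: le_trans (rnormX _ _) _.
  by rewrite lerXn2r ?nnegrE ?rnorm_ge0 ?(ltW M0) // lerDr.
rewrite (zE n.-1) prednK //; apply: le_trans (rnormM _ _) _.
apply: le_trans (ler_pM (rnorm_ge0 _) (rnorm_ge0 _) un yn) _.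
by rewrite -exprMn invfM -mulrA mulVf ?mulr1 ?gt_eqF.
Unshelve. all: by end_near. Qed.

End RootNorm.

(** Telescoping: the innermost [a * x ^+ 2] collapses to [x]. It is applied to [x] and to [d]
    alike. *)
Lemma mulrX_exprS (S : nzRingType) (a x : S) n :
  a * x ^+ 2 = x -> a ^+ n.+1 * x ^+ n.+1 = a * x.
Proof.
move=> ax; elim: n => [|n IHn]; first by [].
rewrite exprSr -mulrA [x ^+ n.+2]exprS [x ^+ n.+1]exprS.
by rewrite !mulrA -(mulrA _ x x) -expr2 -(mulrA _ a) ax -mulrA -exprS.
Qed.

Lemma idem_expr (S : nzRingType) (e : S) n : e * e = e -> e ^+ n.+1 = e.
Proof. by move=> ee; elim: n => // n IHn; rewrite exprS IHn. Qed.

Section GeneralizedRightInverseTheory.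
Variables (R : realType) (A : banachStarAlg R) (a d : A).
Implicit Types (x : A) (m : nat).
Hypothesis da : gen_right_drazin_inverse a d.

Let p := a * d.

Lemma drazin_comm : GRing.comm p a.
Proof. by case: da => _ ada _; rewrite /GRing.comm /p -ada mulrA expr2. Qed.

Lemma drazin_idem : p * p = p.
Proof.
case: da => add _ _.
by rewrite {2}/p mulrA drazin_comm /p -mulrA -(mulrA a) -expr2 add.
Qed.

Lemma drazin_mulr : p * d = d.
Proof. by case: da => add _ _; rewrite /p -mulrA -expr2. Qed.

Lemma drazin_proj_inv x : x = a * x ^+ 2 -> p * x = x.
Proof.
move=> xE; case: da => _ _ qn.
suff paxE : (1 - p) * (a * x) = 0.
  (* As [x = (a * x) * x], it is enough that [1 - p] kills [a * x]. *)
  apply/esym/subr0_eq; rewrite -{1}(mul1r x) -mulrBl {1}xE expr2 !mulrA.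
  by rewrite -(mulrA (1 - p)) paxE mul0r.
apply: (root_norm_cvg0_expr_eq0 _ _ _ x _ qn) => n.
have cp : GRing.comm (1 - p) a.
  by apply/commr_sym/commrB; [exact: commr1 | exact/commr_sym/drazin_comm].
have ip : (1 - p) * (1 - p) = 1 - p.
  by rewrite mulrBr mulr1 mulrBl mul1r drazin_idem subrr subr0.
have -> : a - a * d * a = (1 - p) * a by rewrite mulrBl mul1r.
by rewrite exprMn_comm // idem_expr // -mulrA mulrX_exprS.
Qed.

Lemma proj_inv_drazin x :
  root_norm_cvg0 (fun n => a ^+ n - a * x * a ^+ n) -> a * x * p = p.
Proof.
move=> xcvg; case: da => add _ _.
apply/esym/subr0_eq/(root_norm_cvg0_expr_eq0 _ _ _ d _ xcvg) => n.
by rewrite mulrBl -(mulrA (a * x)) mulrX_exprS.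
Qed.

(** This eliminates [d]: the second equation does not mention it, so the first does not depend on
    the choice of [d]. *)
Lemma star_drazinP m x : (0 < m)%N -> x = a * x ^+ 2 ->
    root_norm_cvg0 (fun n => a ^+ n - a * x * a ^+ n) ->
  star p * a ^+ m.+1 * x = star p * a ^+ m <->
  star (star (a ^+ m) * a ^+ m.+1 * x) = star (a ^+ m) * a ^+ m.+1 * x.
Proof.
case: m => // m _ xE xcvg.
rewrite exprSr -!(mulrA _ _ x).
have px := drazin_proj_inv _ xE; have qp := proj_inv_drazin _ xcvg.
have [add _ _] := da.
set q := a * x in qp *; set b := a ^+ m.+1.
have pq : p * q = q by rewrite /q mulrA drazin_comm -mulrA px.
have qq : q * q = q by rewrite -{2}pq mulrA qp.
have pbq : p * (b * q) = b * q.
  by rewrite mulrA (commrX m.+1 drazin_comm) -mulrA pq.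
have qdX : q * d ^+ m.+1 = d ^+ m.+1.
  by rewrite exprS mulrA -{1}drazin_mulr mulrA qp drazin_mulr.
have pE : p = b * q * d ^+ m.+1 by rewrite -mulrA qdX mulrX_exprS.
rewrite starM starK; split => [pb | sa].
  (* Since [p] fixes [b * q], the factor [star p] in [pb] is absorbed by [star (b * q)]; the
     right-hand side is self-adjoint. *)
  have sbq : star (b * q) * b = star (b * q) * (b * q).
    by rewrite -{1 2}pbq starM -!mulrA pb.
  by rewrite sbq; move/(congr1 (@star _ A)): sbq; rewrite !starM !starK => <-.
(* With the factor [star (d ^+ m.+1)] removed, the claim follows from [sa] and [q * q = q]. *)
rewrite pE starM -!mulrA; congr (_ * _).
by rewrite mulrA sa -(mulrA _ (b * q)) -(mulrA b) qq.
Qed.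

End GeneralizedRightInverseTheory.

Theorem theorem3p1 (R : realType) (A : banachStarAlg R)
    (A_proper : proper_involution A) (a : A) (m : nat) (m_ge1 : (1 <= m)%N) :
  let condition2 (x : A) :=
    [/\ x = a * x ^+ 2,
        star (star (a ^+ m) * a ^+ m.+1 * x) = star (a ^+ m) * a ^+ m.+1 * x &
        root_norm_cvg0 (fun n : nat => a ^+ n - a * x * a ^+ n)] in
  ((exists x : A, gen_right_group_inverse m a x) <->
     (exists d : A, gen_right_drazin_inverse a d) /\
     (exists x : A, condition2 x)) /\
  (forall d x : A, gen_right_drazin_inverse a d -> condition2 x ->
     gen_right_group_inverse m a (a * d * x)).
Proof.
move=> condition2.
have adx d x : gen_right_drazin_inverse a d -> condition2 x ->
    gen_right_group_inverse m a (a * d * x).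
  (* The candidate is [x] itself, since [a * d] fixes [x]. *)
  move=> da [xE sa xcvg]; rewrite (drazin_proj_inv _ _ _ _ da _ xE) //.
  by exists d => //; split=> //; apply/(star_drazinP _ _ _ _ da).
split=> //; split=> [[x [d da [xE pE xcvg]]] | [[d da] [x cx]]].
  split; first by exists d.
  by exists x; split=> //; apply/(star_drazinP _ _ _ _ da).
by exists (a * d * x); exact: adx.
Qed.
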